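(* Let $A$ be an arithmetical algebra and let $\theta\in\mathrm{Con}(A)$. Then: (1) $\theta$ has FCLP if and only if $\theta$ has CBLP; (2) $A$ has FCLP if and only if $A$ has CBLP.
   Context: Algebras are non-empty universal algebras of a fixed arbitrary signature. For an algebra $A$, $\mathrm{Con}(A)$ is the bounded lattice of congruences of $A$ ordered by inclusion, with meet $\cap$, join $\phi\vee\psi$ = the congruence generated by $\phi\cup\psi$, least element $\Delta_A=\{(a,a)\mid a\in A\}$ and greatest element $\nabla_A=A^2$. $A$ is congruence-distributive if the lattice $\mathrm{Con}(A)$ is distributive; quotients of congruence-distributive algebras are congruence-distributive. Composition: $\phi\circ\psi=\{(a,b)\in A^2\mid \exists x\in A,\ (a,x)\in\psi,\ (x,b)\in\phi\}$. $A$ is congruence-permutable if $\phi\circ\psi=\psi\circ\phi$ for all $\phi,\psi\in\mathrm{Con}(A)$, and arithmetical if it is both congruence-distributive and congruence-permutable. For a bounded distributive lattice $L$, $\mathcal{B}(L)$ is the Boolean algebra of complemented elements of $L$. Let $A$ be congruence-distributive. A congruence $\phi$ of $A$ is a factor congruence if there is $\phi^*\in\mathrm{Con}(A)$ with $\phi\vee\phi^*=\nabla_A$, $\phi\cap\phi^*=\Delta_A$ and $\phi\circ\phi^*=\phi^*\circ\phi$. $\mathrm{FC}(A)$ is the set of factor congruences; it is a Boolean subalgebra of $\mathcal{B}(\mathrm{Con}(A))$. For $\theta\in\mathrm{Con}(A)$ and $\alpha\in\mathrm{Con}(A)$ with $\theta\subseteq\alpha$, $\alpha/\theta=\{(a/\theta,b/\theta)\mid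 (a,b)\in\alpha\}\in\mathrm{Con}(A/\theta)$. The map $u_\theta:\mathrm{Con}(A)\to\mathrm{Con}(A/\theta)$, $u_\theta(\alpha)=(\alpha\vee\theta)/\theta$, is a bounded lattice morphism which maps $\mathrm{FC}(A)$ into $\mathrm{FC}(A/\theta)$ and $\mathcal{B}(\mathrm{Con}(A))$ into $\mathcal{B}(\mathrm{Con}(A/\theta))$. The congruence $\theta$ has FCLP (Factor Congruence Lifting Property) if the restriction $u_\theta|:\mathrm{FC}(A)\to\mathrm{FC}(A/\theta)$ is surjective; $\theta$ has CBLP (Congruence Boolean Lifting Property) if the restriction $u_\theta|:\mathcal{B}(\mathrm{Con}(A))\to\mathcal{B}(\mathrm{Con}(A/\theta))$ is surjective. $A$ has FCLP (respectively CBLP) if every congruence of $A$ has FCLP (respectively CBLP). *)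

(* Defs.v *)
From HB Require Import structures.
From mathcomp Require Import all_boot all_order.
From mathcomp Require Import mathcomp_extra boolp classical_sets functions.

Set Implicit Arguments.
Unset Strict Implicit.
Unset Printing Implicit Defensive.

Import Order.TTheory.
Local Open Scope classical_set_scope.

Record signature := Signature {
  symbol :> Type;
  arity : symbol -> nat
}.

Record algebra (S : signature) := Algebra {
  carrier :> Type;
  op : forall f : S, ('I_(arity f) -> carrier) -> carrier;
  carrier_inhabited : inhabited carrier
}.
Arguments op {S a} f u.

Section Congruences.
Variables (S : signature) (A : algebra S).

Definition congruence : set (set (A * A)) := [set r |
  [/\ forall a, r (a, a),
      forall a b, r (a, b) -> r (b, a),
      forall a b c, r (a, b) -> r (b, c) -> r (a, c) &
      forall (f : S) (u v : 'I_(arity f) -> A),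
        (forall i, r (u i, v i)) -> r (op f u, op f v)]].

Record con := Con { con_rel :> set (A * A); con_mem : con_rel \in congruence }.

Set Warnings "-redundant-canonical-projection,-projection-no-head-constant".

HB.instance Definition _ := [isSub for con_rel].
HB.instance Definition _ := [Choice of con by <:].

Fact con_display : Order.disp_t. Proof. by []. Qed.

(* [set (A * A)] is ordered by inclusion; [con] inherits this order. *)
HB.instance Definition _ := [SubChoice_isSubPOrder of con by <: with con_display].

Lemma conP (r : con) : congruence r.
Proof. exact: set_mem (con_mem r). Qed.

Lemma con_leP (r s : con) : reflect (r `<=` s) (r <= s)%O.
Proof. exact: asboolP. Qed.

Lemma con_eq (r s : con) : con_rel r = con_rel s -> r = s.
Proof. exact: val_inj. Qed.

Lemma congruence_bigcap (C : set (set (A * A))) :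
  C `<=` congruence -> congruence (\bigcap_(r in C) r).
Proof.
move=> sC; split.
- by move=> a r /[dup] Cr /sC[].
- by move=> a b ab r /[dup] Cr /sC[_ + _ _]; apply; exact: ab.
- move=> a b c ab bc r /[dup] Cr /sC[_ _ + _]; apply; [exact: ab|exact: bc].
- by move=> f u v uv r /[dup] Cr /sC[_ _ _]; apply=> i; exact: uv.
Qed.

Lemma congruenceI (r s : con) : congruence (r `&` s).
Proof.
case: (conP r) (conP s) => [rr rs rt rc] [sr ss st sc]; split=> [a|a b|a b c|f u v].
- by split.
- by move=> [/rs ? /ss ?].
- by move=> [rab sab] [rbc sbc]; split; [exact: rt rbc|exact: st sbc].
- by move=> uv; split; [apply: rc|apply: sc] => i; case: (uv i).
Qed.

Lemma congruence_smallest (G : set (A * A)) : congruence (smallest congruence G).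
Proof. by apply: congruence_bigcap => r []. Qed.

Lemma congruence_diagonal : congruence (@diagonal A).
Proof.
rewrite /diagonal; split=> /= [//|a b ->//|a b c ->//|f u v uv].
by congr op; apply/funext.
Qed.

Lemma congruenceT : congruence [set: A * A]. Proof. by []. Qed.

Definition con_meet (r s : con) : con := Con (mem_set (congruenceI r s)).
Definition con_join (r s : con) : con :=
  Con (mem_set (congruence_smallest (r `|` s))).
Definition con_bot : con := Con (mem_set congruence_diagonal).
Definition con_top : con := Con (mem_set congruenceT).

Lemma con_meetP r s t : (r <= con_meet s t = (r <= s) && (r <= t))%O.
Proof.
apply/con_leP/andP => [|[/con_leP rs /con_leP rt]]; last by rewrite subsetI.
by rewrite subsetI => -[rs rt]; split; apply/con_leP.
Qed.

Lemma con_joinP r s t : (con_join r s <= t = (r <= t) && (s <= t))%O.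
Proof.
apply/con_leP/andP => [rst|[/con_leP rt /con_leP st]].
  by split; apply/con_leP => x rx; apply: rst; apply: sub_gen_smallest;
    [left|right].
by apply: smallest_sub; [exact: conP|rewrite subUset].
Qed.

Lemma con_le0x r : (con_bot <= r)%O.
Proof. by apply/con_leP => -[a b]; rewrite /= => /diagonalP ->; case: (conP r). Qed.

Lemma con_lex1 r : (r <= con_top)%O.
Proof. exact/con_leP. Qed.

HB.instance Definition _ := Order.POrder_MeetJoin_isLattice.Build con_display con
  con_meetP con_joinP.
HB.instance Definition _ := Order.hasBottom.Build con_display con con_le0x.
HB.instance Definition _ := Order.hasTop.Build con_display con con_lex1.

Definition congruence_distributive : Prop :=
  @left_distributive con con Order.meet Order.join.

(* [s \; r] is applicative composition: its members are the pairs (a, b) with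
   (a, x) in r and (x, b) in s for some x. *)
Definition permuting (r s : set (A * A)) : Prop := (r \; s = s \; r)%relation.

Definition congruence_permutable : Prop := forall r s : con, permuting r s.

Definition arithmetical : Prop :=
  congruence_distributive /\ congruence_permutable.

Definition factor_congruences : set con := [set r | exists s : con,
  [/\ Order.join r s = Order.top, Order.meet r s = Order.bottom & permuting r s]].

End Congruences.

Definition complemented {d} {L : tbLatticeType d} : set L := [set x |
  exists y : L, Order.join x y = Order.top /\ Order.meet x y = Order.bottom].

Section Quotient.
Variables (S : signature) (A : algebra S) (t : con A).

Definition eqclass (a : A) : set A := [set b | con_rel t (a, b)].

Definition quot_carrier : Type := set_type (range eqclass).

Definition quot_pi (a : A) : quot_carrier := SigSub (mem_set (imageT eqclass a)).

Lemma quot_piP a b : quot_pi a = quot_pi b <-> con_rel t (a, b).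
Proof.
have [tr ts tt _] := conP t; split => [/(congr1 val)/= /seteqP[_ /(_ b)]|ab].
  by apply; exact: tr.
apply/val_inj/seteqP; split=> c; rewrite /eqclass /= => h.
  by apply: tt h; exact: ts.
exact: tt ab h.
Qed.

Lemma quot_pi_surj (x : quot_carrier) : exists a, quot_pi a = x.
Proof. by have [a _ ax] := set_mem (valP x); exists a; exact: val_inj. Qed.

Definition quot_repr (x : quot_carrier) : A := sval (cid (quot_pi_surj x)).

Lemma quot_reprK : cancel quot_repr quot_pi.
Proof. by move=> x; rewrite /quot_repr; case: cid. Qed.

(* By [quot_opE] below, the choice of representatives is immaterial. *)
Definition quotient : algebra S := {|
  carrier := quot_carrier;
  op f u := quot_pi (op f (quot_repr \o u));
  carrier_inhabited :=
    let: inhabits a := carrier_inhabited A in inhabits (quot_pi a) |}.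

Lemma quot_opE (f : S) (u : 'I_(arity f) -> A) :
  @op S quotient f (quot_pi \o u) = quot_pi (op f u).
Proof.
have [_ _ _ tc] := conP t; apply/quot_piP/tc => i.
by apply/quot_piP; rewrite /= quot_reprK.
Qed.

Definition quot_rel (r : set (A * A)) : set (quotient * quotient) :=
  (fun p => (quot_pi p.1, quot_pi p.2)) @` r.

Lemma quot_relP (r : con A) a b :
  (t <= r)%O -> quot_rel r (quot_pi a, quot_pi b) <-> con_rel r (a, b).
Proof.
move=> /con_leP tr; have [_ rs rt _] := conP r; split=> [|rab]; last first.
  by exists (a, b).
move=> [[c d] rcd e].
have /quot_piP ca : quot_pi c = quot_pi a := congr1 fst e.
have /quot_piP db : quot_pi d = quot_pi b := congr1 snd e.
exact: rt (rt _ _ _ (rs _ _ (tr _ ca)) rcd) (tr _ db).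
Qed.

Lemma congruence_quot_rel (r : con A) : (t <= r)%O -> congruence (quot_rel r).
Proof.
move=> tr; have [rr rs rt rc] := conP r; split.
- by move=> x; have [a <-] := quot_pi_surj x; apply/quot_relP.
- move=> x y; have [a <-] := quot_pi_surj x; have [b <-] := quot_pi_surj y.
  by move=> /(quot_relP _ _ tr)/rs ?; apply/quot_relP.
- move=> x y z; have [a <-] := quot_pi_surj x; have [b <-] := quot_pi_surj y.
  have [c <-] := quot_pi_surj z.
  move=> /(quot_relP _ _ tr) ab /(quot_relP _ _ tr) bc.
  by apply/quot_relP => //; exact: rt bc.
- move=> f u v uv; apply/quot_relP => //; apply: rc => i /=.
  by apply/(quot_relP _ _ tr); rewrite !quot_reprK.
Qed.

Definition quot_con (r : con A) (tr : (t <= r)%O) : con quotient :=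
  Con (mem_set (congruence_quot_rel tr)).

Definition quot_map (r : con A) : con quotient :=
  quot_con (leUr t r : (t <= Order.join r t)%O).

Definition con_FCLP : Prop :=
  set_surj (@factor_congruences S A) (@factor_congruences S quotient) quot_map.

Definition con_CBLP : Prop :=
  set_surj (complemented : set (con A)) (complemented : set (con quotient)) quot_map.

End Quotient.

Definition FCLP (S : signature) (A : algebra S) : Prop :=
  forall t : con A, con_FCLP t.

Definition CBLP (S : signature) (A : algebra S) : Prop :=
  forall t : con A, con_CBLP t.

(* Main.v *)
(** If all congruences of [A] permute, then [factor_congruences] is just
    [complemented]. Permutability passes to [A / theta], because the congruences
    of the quotient pull back to congruences of [A], so in both lattices the two
    sets agree and the two lifting properties are the same statement. *)

From mathcomp Require Import all_boot all_order.
From mathcomp Require Import boolp classical_sets functions.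
Require Import Defs.

Set Implicit Arguments.
Unset Strict Implicit.
Unset Printing Implicit Defensive.

Local Open Scope classical_set_scope.

Lemma factor_congruences_permutable (S : signature) (A : algebra S) :
  congruence_permutable A -> @factor_congruences S A = complemented.
Proof.
by move=> pA; apply/seteqP; split=> r [s]; [case=> ? ? _|case]; exists s; split.
Qed.

Section QuotientPermutable.
Variables (S : signature) (A : algebra S) (t : con A).

Lemma congruence_preimage_quot_pi (r : con (quotient t)) :
  congruence [set p : A * A | con_rel r (quot_pi t p.1, quot_pi t p.2)].
Proof.
have [rr rs rt rc] := conP r; split=> [a|a b|a b c|f u v uv] /=.
- exact: rr.
- exact: rs.
- exact: rt.
(* The projection commutes with [op], so compatibility of [r] applies. *)
- by rewrite -!quot_opE; apply: rc.
Qed.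

Definition con_preimage (r : con (quotient t)) : con A :=
  Con (mem_set (congruence_preimage_quot_pi r)).

(** A chain [x], [z], [y] of classes lifts to representatives [a], [b], [c] related by the
    preimages; the new midpoint [d] found in [A] projects back. *)
Lemma congruence_permutable_quotient :
  congruence_permutable A -> congruence_permutable (quotient t).
Proof.
move=> pA.
(* Exchanging [r] and [s] gives the other inclusion. *)
suff sub (r s : con (quotient t)) :
    (con_rel r \; con_rel s `<=` con_rel s \; con_rel r)%relation.
  by move=> r s; apply/seteqP; split; exact: sub.
move=> [x y] [z /= rxz szy].
have [[a ax] [b bz]] := (quot_pi_surj x, quot_pi_surj z).
have [c cy] := quot_pi_surj y.
have : (con_rel (con_preimage r) \; con_rel (con_preimage s))%relation (a, c).
  by exists b; rewrite /= ?ax ?bz ?cy.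
rewrite pA => -[d /= sad rdc].
by exists (quot_pi t d); rewrite /= -?ax -?cy.
Qed.

End QuotientPermutable.

(** An equality of propositions, so that it rewrites at each congruence. *)
Lemma con_FCLP_permutable (S : signature) (A : algebra S) (t : con A) :
  congruence_permutable A -> con_FCLP t = con_CBLP t.
Proof.
move=> pA; rewrite /con_FCLP /con_CBLP !factor_congruences_permutable //.
exact: congruence_permutable_quotient.
Qed.

Theorem proposition3p11 (S : signature) (A : algebra S) (theta : con A) :
  arithmetical A ->
  (con_FCLP theta <-> con_CBLP theta) /\ (FCLP A <-> CBLP A).
Proof.
move=> [_ pA]; rewrite con_FCLP_permutable //; split=> //.
by split=> h t; move: (h t); rewrite con_FCLP_permutable.
Qed.
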